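(* Let $X$ be a locally compact, geodesically complete CAT(0) space, let $o\in X$, and let $p\in X$ be at distance $R>0$ from $o$. Then there exists $\epsilon>0$ such that for all $0<s<\epsilon$, the intersection $S_s(p)\cap\bar B_R(o)$ of the distance sphere $S_s(p)=\{x\in X:d(p,x)=s\}$ with the closed ball $\bar B_R(o)=\{x\in X:d(o,x)\le R\}$ is contractible.
   Context: A CAT(0) space is a complete metric space in which any two points are joined by a geodesic and in which all geodesic triangles are not thicker than their comparison triangles in the Euclidean plane. It is geodesically complete if every isometric embedding of an interval extends to a locally isometric embedding of $\mathbb{R}$. *)

(* Defs.v *)
From HB Require Import structures.
From mathcomp Require Import all_boot all_order all_algebra.
From mathcomp Require Import all_classical all_reals all_analysis.

Set Implicit Arguments.
Unset Strict Implicit.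
Unset Printing Implicit Defensive.

Import Order.TTheory GRing.Theory Num.Theory.
Import numFieldNormedType.Exports.

Local Open Scope classical_set_scope.
Local Open Scope ring_scope.

(* The field of [completeType], without the base point that [completeType]
   carries. *)
Definition complete_space (T : uniformType) : Prop :=
  forall F : set_system T, ProperFilter F -> cauchy F -> exists x : T, F --> x.

Section metric_geometry.
Context {R : realType} {X : metricType R}.
Implicit Types (x y o p : X) (c : R -> X) (I : set R).

Definition distance_sphere p (s : R) : set X := [set x | mdist p x = s].

(* This may be larger than the closure of the open ball. *)
Definition closed_distance_ball o (r : R) : set X := [set x | mdist o x <= r].

(* Values of [c] outside [I] are irrelevant. *)
Definition isometric_on I c : Prop :=
  forall s t : R, I s -> I t -> mdist (c s) (c t) = `|s - t|.

Definition locally_isometric c : Prop :=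
  forall t : R, exists2 e : R, 0 < e & isometric_on `]t - e, t + e[ c.

Definition is_geodesic x y c : Prop :=
  [/\ c 0 = x, c (mdist x y) = y & isometric_on `[0, mdist x y] c].

End metric_geometry.

(* The matrix library norms ['rV[R]_2] by the maximum of the coordinates,
   hence an explicit Euclidean distance. *)
Definition euclidean_dist {R : realType} (u v : 'rV[R]_2) : R :=
  Num.sqrt (\sum_(k < 2) (u 0 k - v 0 k) ^+ 2).

(* The point at distance [t] from [u] on the segment from [u] to [v], where
   [l] is the length of the segment and [0 <= t <= l]. It is [u] if [l = 0],
   since [0^-1 = 0]. *)
Definition segment_point {R : realType} (u v : 'rV[R]_2) (l t : R) : 'rV[R]_2 :=
  u + (t / l) *: (v - u).

Section cat0.
Context {R : realType}.

(* The vertices of a triangle are indexed by ['I_3]; side [i] goes from vertex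
   [i] to vertex [ordS i], its cyclic successor. *)
Definition geodesic_triangle {X : metricType R}
    (v : 'I_3 -> X) (c : 'I_3 -> R -> X) : Prop :=
  forall i, is_geodesic (v i) (v (ordS i)) (c i).

Definition comparison_triangle {X : metricType R}
    (v : 'I_3 -> X) (w : 'I_3 -> 'rV[R]_2) : Prop :=
  forall i, euclidean_dist (w i) (w (ordS i)) = mdist (v i) (v (ordS i)).

Definition not_thicker {X : metricType R}
    (v : 'I_3 -> X) (c : 'I_3 -> R -> X) (w : 'I_3 -> 'rV[R]_2) : Prop :=
  let l i := mdist (v i) (v (ordS i)) in
  let wpt i t := segment_point (w i) (w (ordS i)) (l i) t in
  forall (i j : 'I_3) (s t : R), 0 <= s <= l i -> 0 <= t <= l j ->
    mdist (c i s) (c j t) <= euclidean_dist (wpt i s) (wpt j t).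

Definition cat0_space (X : metricType R) : Prop :=
  [/\ complete_space X,
      forall x y : X, exists c : R -> X, is_geodesic x y c &
      forall (v : 'I_3 -> X) (c : 'I_3 -> R -> X) (w : 'I_3 -> 'rV[R]_2),
        geodesic_triangle v c -> comparison_triangle v w -> not_thicker v c w].

Definition geodesically_complete (X : metricType R) : Prop :=
  forall (I : set R) (c : R -> X), is_interval I -> isometric_on I c ->
    exists2 g : R -> X, locally_isometric g & forall t, I t -> g t = c t.

(* Contractibility of [A] with the subspace topology: [H] is a homotopy inside
   [A] from the identity of [A] to a constant map. It is constrained only on
   [A `*` `[0, 1]]. *)
Definition contractible {T : topologicalType} (A : set T) : Prop :=
  exists2 a : T, A a & exists H : T * R -> T,
    [/\ {within A `*` `[0, 1], continuous H},
        forall x t, A x -> 0 <= t <= 1 -> A (H (x, t)),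
        forall x, A x -> H (x, 0) = x &
        forall x, A x -> H (x, 1) = a].

End cat0.
Arguments contractible R {T} A.

(* Main.v *)
Require Import Defs.
From mathcomp Require Import all_boot all_order all_algebra.
From mathcomp Require Import all_classical all_reals all_analysis.
From mathcomp Require Import ring lra.

Set Implicit Arguments.
Unset Strict Implicit.
Unset Printing Implicit Defensive.

Import Order.TTheory GRing.Theory Num.Theory.
Import numFieldNormedType.Exports.

Local Open Scope classical_set_scope.
Local Open Scope ring_scope.

(** Write A for the intersection of the sphere S_s(p) with the closed ball of
    radius r = d(o, p) around o, and let q be the point of A on the geodesic
    from p to o. The geodesic from a point x of A to q stays in both balls by
    convexity, but it leaves the sphere: it runs inside the ball around p. The
    proof pushes it back to the sphere, away from p, without leaving the ball
    around o. So A is a retract of a region W that contains all these geodesics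
    ([contractible_geodesic_retract]).

    Pushing away from p means moving along a prolongation of the geodesic from p
    to m beyond m. Prolongations exist by geodesic completeness, since local
    geodesics are geodesics ([geodesic_extension]). They may branch, so in
    general none can be chosen continuously. Two facts, both valid near p only, repair this.

    - Prolongations are almost unique. If z_t is the point at ratio t on the
      geodesic from p to z, then d(z_t, z'_t) / t is nondecreasing in t, hence
      has a limit as t tends to 0. A small ball around p is compact and these
      quotients are Lipschitz in z and z', so the convergence is uniform
      ([uniform_infimum], a form of Dini's theorem). If z_a and z'_a are close
      relative to a for one a, then the limit is small, so z_t and z'_t are close
      relative to t for every t below a threshold that does not depend on z, z'.

    - Pushing a point of the ball around o hardly increases the distance to o.
      The slope (d(o, z_t) - d(o, p)) / t is nondecreasing in t by convexity of
      d(o, .), and its convergence is uniform as well; it is nonpositive at t = a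
      if z_a lies in the ball around o, hence almost nonpositive at the threshold.

    Prolongations to a fixed radius L are therefore, up to a small multiple of L,
    given by a continuous map Z ([radial_extension], [continuous_selection]).
    Moving m towards Z(m) by about half of u(m) = s - d(p, m) defines a
    continuous map G that fixes the sphere, shrinks u by a definite factor and
    increases d(o, .) by at most u / 8 ([radial_push]). The iterates of G converge
    uniformly to a retraction onto u = 0
    ([retraction_of_contracting_iteration]). The total increase of d(o, .) is at
    most u / 2, and there is room for it: at ratio t of the geodesic from x to q the
    distance to o is at most r - t s by convexity, since d(o, q) = r - s, while
    u <= t d(x, q) <= 2 t s ([geodesic_in_push_region]). *)

(** * Comparison triangles and Stewart's inequality *)

Section euclidean_plane.
Context {R : realType}.
Implicit Types (u v w : 'rV[R]_2) (a b c t : R).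

Definition plane_vector a b : 'rV[R]_2 := \row_(k < 2) (if k == 0 then a else b).

Lemma euclidean_dist_sqr u v :
  euclidean_dist u v ^+ 2 = (u 0 0 - v 0 0) ^+ 2 + (u 0 1 - v 0 1) ^+ 2.
Proof.
rewrite /euclidean_dist sqr_sqrtr; last by apply: sumr_ge0 => k _; exact: sqr_ge0.
by rewrite !big_ord_recl big_ord0 addr0 (_ : lift ord0 ord0 = 1)//; apply/val_inj.
Qed.

Lemma euclidean_dist_eq u v a : 0 <= a ->
  (u 0 0 - v 0 0) ^+ 2 + (u 0 1 - v 0 1) ^+ 2 = a ^+ 2 -> euclidean_dist u v = a.
Proof.
move=> a0; rewrite -euclidean_dist_sqr => /eqP; rewrite eqrXn2 ?sqrtr_ge0//.
by move=> /eqP.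
Qed.

Lemma euclidean_distC u v : euclidean_dist u v = euclidean_dist v u.
Proof. by rewrite /euclidean_dist; congr Num.sqrt; apply: eq_bigr => k _; ring. Qed.

(** Stewart's theorem, for the point that divides the segment from [u] to [v] in
    the ratio [t]. *)
Lemma euclidean_stewart u v w t :
  euclidean_dist w (u + t *: (v - u)) ^+ 2 =
  (1 - t) * euclidean_dist w u ^+ 2 + t * euclidean_dist w v ^+ 2
  - t * (1 - t) * euclidean_dist u v ^+ 2.
Proof. by rewrite !euclidean_dist_sqr !mxE; ring. Qed.

(** The third vertex has abscissa [h] by the law of cosines; the triangle
    inequalities say that [h] is at most [b] in absolute value, by Heron's
    factorization. If [a = 0] then [h = 0], since [0^-1 = 0], and the formulas
    still hold. *)
Lemma triangle_in_plane a b c : 0 <= a -> 0 <= b -> 0 <= c ->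
  a <= b + c -> b <= a + c -> c <= a + b ->
  exists u v w, [/\ euclidean_dist u v = a, euclidean_dist v w = c &
                   euclidean_dist w u = b].
Proof.
move=> a0 b0 c0 abc bac cab.
pose h := (a ^+ 2 + b ^+ 2 - c ^+ 2) / (2 * a).
have h2 : h ^+ 2 <= b ^+ 2.
  have [aE|aN0] := eqVneq a 0.
    by rewrite /h aE mulr0 invr0 mulr0 expr0n/= sqr_ge0.
  have a_gt0 : 0 < a by rewrite lt_neqAle eq_sym aN0.
  have ah : 2 * a * h = a ^+ 2 + b ^+ 2 - c ^+ 2.
    by rewrite /h mulrC divfK// mulf_neq0// pnatr_eq0.
  rewrite -subr_ge0 -(pmulr_rge0 _ (_ : 0 < (2 * a) ^+ 2)); last first.
    by rewrite exprn_gt0// mulr_gt0.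
  have -> : (2 * a) ^+ 2 * (b ^+ 2 - h ^+ 2) =
      (2 * a * b - 2 * a * h) * (2 * a * b + 2 * a * h) by ring.
  rewrite ah.
  have -> : 2 * a * b - (a ^+ 2 + b ^+ 2 - c ^+ 2) = (c - a + b) * (c + a - b) by ring.
  have -> : 2 * a * b + (a ^+ 2 + b ^+ 2 - c ^+ 2) = (a + b - c) * (a + b + c) by ring.
  by rewrite !mulr_ge0//; lra.
exists (plane_vector 0 0), (plane_vector a 0).
exists (plane_vector h (Num.sqrt (b ^+ 2 - h ^+ 2))).
have hk : Num.sqrt (b ^+ 2 - h ^+ 2) ^+ 2 = b ^+ 2 - h ^+ 2.
  by rewrite sqr_sqrtr// subr_ge0.
split; apply: euclidean_dist_eq => //; rewrite !mxE/=.
- by ring.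
- rewrite sub0r sqrrN hk.
  have [aE|aN0] := eqVneq a 0.
    have -> : h = 0 by rewrite /h aE mulr0 invr0 mulr0.
    have -> : b = c by lra.
    rewrite aE; ring.
  rewrite sqrrB.
  have -> : a ^+ 2 - a * h *+ 2 = a ^+ 2 - 2 * a * h by ring.
  have -> : 2 * a * h = a ^+ 2 + b ^+ 2 - c ^+ 2.
    by rewrite /h mulrC divfK// mulf_neq0// pnatr_eq0.
  by ring.
- by rewrite !subr0 hk; ring.
Qed.

End euclidean_plane.

Section triangle_comparison.
Context {R : realType} {X : metricType R}.
Hypothesis X_cat0 : cat0_space X.
Implicit Types (x y z : X) (t : R).

(** The only use of triangle comparison in the proof: the vertex [z] is compared
    with a point of the opposite side, and Stewart's theorem computes the
    distance in the plane. *)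
Lemma stewart_geodesic x y z c t : is_geodesic x y c -> 0 <= t <= 1 ->
  mdist z (c (t * mdist x y)) ^+ 2 <=
  (1 - t) * mdist z x ^+ 2 + t * mdist z y ^+ 2 - t * (1 - t) * mdist x y ^+ 2.
Proof.
move=> cxy t01; have [_ geo thin] := X_cat0.
have [c1 c1P] := geo y z; have [c2 c2P] := geo z x.
have [u [v [w [uv vw wu]]]] : exists u v w : 'rV[R]_2,
    [/\ euclidean_dist u v = mdist x y, euclidean_dist v w = mdist y z &
        euclidean_dist w u = mdist z x].
  have xyz := metric_triangle x y z; have yzx := metric_triangle y z x.
  have zxy := metric_triangle z x y.
  move: xyz yzx zxy; rewrite [mdist y x]metric_sym [mdist z y]metric_sym.
  rewrite [mdist x z]metric_sym => xyz yzx zxy.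
  by apply: triangle_in_plane; rewrite ?mdist_ge0//; lra.
pose vs (i : 'I_3) := nth x [:: x; y; z] i.
pose cs (i : 'I_3) := nth c [:: c; c1; c2] i.
pose ws (i : 'I_3) := nth u [:: u; v; w] i.
have geos : geodesic_triangle vs cs.
  by move=> i; case: i => -[|[|[|//]]] i3.
have comps : comparison_triangle vs ws.
  by move=> i; case: i => -[|[|[|//]]] i3.
have := thin vs cs ws geos comps ord0 ord_max (t * mdist x y) 0.
rewrite /=; have -> : vs ord0 = x by [].
have -> : vs (ordS ord0) = y by [].
have -> : ws ord0 = u by []. have -> : ws (ordS ord0) = v by [].
have -> : ws ord_max = w by []. have -> : cs ord_max = c2 by [].
have -> : cs ord0 = c by [].
case/andP: t01 => t0 t1.
have l0 := mdist_ge0 x y.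
rewrite mulr_ge0// ler_piMl// lexx mdist_ge0 => /(_ isT isT).
rewrite {2}/segment_point mul0r scale0r addr0; have [-> _ _] := c2P.
rewrite -(@ler_pXn2r _ 2) ?nnegrE ?mdist_ge0 ?sqrtr_ge0// metric_sym => /le_trans; apply.
rewrite euclidean_distC /segment_point.
have [l_eq0|lN0] := eqVneq (mdist x y) 0.
  rewrite l_eq0 mulr0 mul0r scale0r addr0 wu expr0n mulr0 subr0.
  by have /mdist_positivity -> := l_eq0; rewrite -mulrDl subrK mul1r.
by rewrite mulfK// euclidean_stewart wu uv euclidean_distC vw [mdist y z]metric_sym.
Qed.

End triangle_comparison.

(** * Convexity of the distance *)

Section geodesic_point.
Context {R : realType} {X : metricType R}.
Implicit Types (x y z m : X) (s t : R).

(** The point at distance [t * mdist x y] from [x] on the geodesic from [x] to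
    [y]. For [t] in the unit interval the two equations determine it in a CAT(0)
    space, so no choice of geodesics is involved. *)
Definition geodesic_point x y t : X :=
  xget x [set m | mdist x m = t * mdist x y /\ mdist m y = (1 - t) * mdist x y].

Hypothesis X_cat0 : cat0_space X.
Local Notation gp := geodesic_point.

Lemma geodesic_pointP x y t : 0 <= t <= 1 ->
  mdist x (gp x y t) = t * mdist x y /\ mdist (gp x y t) y = (1 - t) * mdist x y.
Proof.
move=> /andP[t0 t1]; rewrite /geodesic_point.
case: xgetP => [m ->//|none]; exfalso.
have [_ geo _] := X_cat0; have [c [c0 cl iso]] := geo x y.
have l0 := mdist_ge0 x y.
apply: (none (c (t * mdist x y))); split.
- rewrite -{1}c0 iso/= ?in_itv/= ?lexx ?l0 ?mulr_ge0 ?ler_piMl//.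
  by rewrite sub0r normrN ger0_norm// mulr_ge0.
- rewrite -{2}cl iso/= ?in_itv/= ?lexx ?l0 ?mulr_ge0 ?ler_piMl//.
  by rewrite distrC ger0_norm ?subr_ge0 ?ler_piMl//; ring.
Qed.

Lemma mdist_geodesic_point x y t : 0 <= t <= 1 ->
  mdist x (gp x y t) = t * mdist x y.
Proof. by case/(geodesic_pointP x y). Qed.

Lemma geodesic_point_mdist x y t : 0 <= t <= 1 ->
  mdist (gp x y t) y = (1 - t) * mdist x y.
Proof. by case/(geodesic_pointP x y). Qed.

(** Stewart's inequality bounds the distance between [m] and the point of the
    geodesic by 0. *)
Lemma geodesic_point_unique x y m t : 0 <= t <= 1 ->
  mdist x m <= t * mdist x y -> mdist m y <= (1 - t) * mdist x y ->
  m = gp x y t.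
Proof.
have [_ geo _] := X_cat0; have [c cxy] := geo x y.
have [c0 cl iso] := cxy.
suff E n : 0 <= t <= 1 -> mdist x n <= t * mdist x y ->
    mdist n y <= (1 - t) * mdist x y -> n = c (t * mdist x y).
  move=> t01 xm my; rewrite [LHS]E// [RHS]E//.
  - by rewrite mdist_geodesic_point.
  - by rewrite geodesic_point_mdist.
move=> t01 xn ny; apply: mdist_positivity; apply/eqP.
rewrite -sqrf_eq0 eq_le sqr_ge0 andbT.
apply: le_trans (stewart_geodesic X_cat0 n cxy t01) _.
case/andP: t01 => t0 t1.
have {}xn : mdist n x ^+ 2 <= (t * mdist x y) ^+ 2.
  by rewrite metric_sym lerXn2r ?nnegrE ?mdist_ge0 ?mulr_ge0 ?mdist_ge0.
have {}ny : mdist n y ^+ 2 <= ((1 - t) * mdist x y) ^+ 2.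
  by rewrite lerXn2r ?nnegrE ?mdist_ge0 ?mulr_ge0 ?mdist_ge0 ?subr_ge0.
have /ler_wpM2l/(_ _ _ xn) : 0 <= 1 - t by rewrite subr_ge0.
have /ler_wpM2l/(_ _ _ ny) := t0; lra.
Qed.

Lemma stewart z x y t : 0 <= t <= 1 ->
  mdist z (gp x y t) ^+ 2 <=
  (1 - t) * mdist z x ^+ 2 + t * mdist z y ^+ 2 - t * (1 - t) * mdist x y ^+ 2.
Proof.
move=> t01; have [_ geo _] := X_cat0; have [c cxy] := geo x y.
suff <- : c (t * mdist x y) = gp x y t by exact: stewart_geodesic.
have [c0 cl iso] := cxy; have l0 := mdist_ge0 x y; case/andP: (t01) => t0 t1.
apply: geodesic_point_unique => //.
- rewrite -{1}c0 iso/= ?in_itv/= ?lexx ?l0 ?mulr_ge0 ?ler_piMl//.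
  by rewrite sub0r normrN ger0_norm// mulr_ge0.
- rewrite -{2}cl iso/= ?in_itv/= ?lexx ?l0 ?mulr_ge0 ?ler_piMl//.
  by rewrite distrC ger0_norm ?subr_ge0 ?ler_piMl//; lra.
Qed.

Lemma geodesic_pointC x y t : 0 <= t <= 1 -> gp x y t = gp y x (1 - t).
Proof.
move=> t01; have u01 : 0 <= 1 - t <= 1 by lra.
apply: geodesic_point_unique => //.
- by rewrite metric_sym geodesic_point_mdist// [mdist y x]metric_sym.
- by rewrite metric_sym mdist_geodesic_point// [mdist y x]metric_sym subKr.
Qed.

Lemma geodesic_point0 x y : gp x y 0 = x.
Proof.
by apply/esym/geodesic_point_unique; rewrite ?lexx ?ler01// ?mdistxx ?mul0r ?subr0 ?mul1r.
Qed.

Lemma geodesic_point1 x y : gp x y 1 = y.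
Proof. by rewrite geodesic_pointC ?ler01 ?lexx// subrr geodesic_point0. Qed.

Lemma geodesic_pointxx x t : 0 <= t <= 1 -> gp x x t = x.
Proof.
by move=> t01; apply/esym/geodesic_point_unique => //; rewrite mdistxx mulr0.
Qed.

Lemma geodesic_point_geodesic_point x y s t : 0 <= s <= 1 -> 0 <= t <= 1 ->
  gp x (gp x y s) t = gp x y (t * s).
Proof.
move=> s01 t01; have l0 := mdist_ge0 x y.
have ts01 : 0 <= t * s <= 1.
  by case/andP: s01 => ? ?; case/andP: t01 => ? ?; rewrite mulr_ge0// mulr_ile1.
apply: geodesic_point_unique => //.
  by rewrite !mdist_geodesic_point// mulrA.
apply: le_trans (metric_triangle _ (gp x y s) _) _.
by rewrite !geodesic_point_mdist// mdist_geodesic_point//; lra.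
Qed.

Lemma geodesic_point_lip x y s t : 0 <= s <= 1 -> 0 <= t <= 1 ->
  mdist (gp x y s) (gp x y t) <= `|s - t| * mdist x y.
Proof.
move=> s01 t01; have l0 := mdist_ge0 x y.
rewrite -(@ler_pXn2r _ 2) ?nnegrE ?mulr_ge0 ?mdist_ge0//.
apply: le_trans (stewart _ _ _ t01) _.
rewrite metric_sym mdist_geodesic_point// geodesic_point_mdist// !exprMn real_normK ?num_real//.
by rewrite le_eqVlt; apply/orP; left; apply/eqP; ring.
Qed.

(** Two applications of Stewart's inequality, first to the side from [x] to [y],
    then to the side from [x] to [z]; all terms but one cancel. *)
Lemma geodesic_point_scale x y z t : 0 <= t <= 1 ->
  mdist (gp x y t) (gp x z t) <= t * mdist y z.
Proof.
move=> t01; case/andP: (t01) => t0 t1.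
rewrite -(@ler_pXn2r _ 2) ?nnegrE ?mulr_ge0 ?mdist_ge0//.
apply: le_trans (stewart _ _ _ t01) _.
rewrite metric_sym mdist_geodesic_point// [mdist _ z]metric_sym.
have /ler_wpM2l/(_ _ _ (stewart z x y t01)) := t0.
rewrite [mdist z x]metric_sym [mdist z y]metric_sym; lra.
Qed.

Lemma busemann_convex x y x' y' t : 0 <= t <= 1 ->
  mdist (gp x y t) (gp x' y' t) <= (1 - t) * mdist x x' + t * mdist y y'.
Proof.
move=> t01; apply: le_trans (metric_triangle _ (gp x y' t) _) _.
rewrite addrC lerD ?geodesic_point_scale//.
have u01 : 0 <= 1 - t <= 1 by lra.
by rewrite (geodesic_pointC x)// (geodesic_pointC x')// geodesic_point_scale.
Qed.

Lemma mdist_convex z x y t : 0 <= t <= 1 ->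
  mdist z (gp x y t) <= (1 - t) * mdist z x + t * mdist z y.
Proof. by move=> t01; rewrite -{1}(geodesic_pointxx z t01) busemann_convex. Qed.

Lemma mdist_geodesic_point_le x y s x' y' t : 0 <= s <= 1 -> 0 <= t <= 1 ->
  mdist (gp x y s) (gp x' y' t) <=
  mdist x x' + mdist y y' + `|s - t| * mdist x y.
Proof.
move=> s01 t01; apply: le_trans (metric_triangle _ (gp x y t) _) _.
rewrite addrC lerD ?geodesic_point_lip//.
apply: le_trans (busemann_convex _ _ _ _ t01) _; case/andP: t01 => t0 t1.
by rewrite lerD// ler_piMl ?mdist_ge0// lerBlDr lerDl.
Qed.

(** * Prolongation of geodesics *)

(** Let [g] be a geodesic on [0, T]. If the distance from [g 0] to [g (T + h)]
    were less than [T + h], then scaling down the triangle with apex [g T] would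
    give two points of [g] near [g T] whose distance is less than their parameter
    distance, against the local isometry. *)
Lemma local_geodesic_step (g : R -> X) (T e h : R) :
  isometric_on `]T - e, T + e[ g ->
  (forall u, 0 <= u <= T -> mdist (g 0) (g u) = u) ->
  0 <= T -> 0 <= h < e -> mdist (g 0) (g (T + h)) = T + h.
Proof.
move=> iso gT T0 /andP[h0 he].
have e0 : 0 < e by exact: le_lt_trans he.
have gTT : mdist (g 0) (g T) = T by rewrite gT ?T0 ?lexx.
have gTh : mdist (g T) (g (T + h)) = h.
  by rewrite iso/= ?in_itv/=; [rewrite distrC addrAC subrr add0r ger0_norm|lra|lra].
apply/eqP; rewrite eq_le; apply/andP; split.
  by have := metric_triangle (g 0) (g T) (g (T + h)); rewrite gTT gTh.
(* small enough for both scaled points to have parameters in ]T - e, T + e[ *)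
pose t := e / (e + T); have eT0 : 0 < e + T by lra.
have t0 : 0 < t by rewrite divr_gt0.
have t1 : t <= 1 by rewrite ler_pdivrMr//; lra.
have tT : t * T < e.
  rewrite mulrAC ltr_pdivrMr//; have := mulr_gt0 e0 e0; lra.
have th : t * h < e by apply: le_lt_trans he; rewrite ler_piMl.
have tT0 : 0 <= t * T by rewrite mulr_ge0// ltW.
have tTT : t * T <= T by rewrite ler_piMl.
have th0 : 0 <= t * h by rewrite mulr_ge0// ltW.
have thh : t * h <= h by rewrite ler_piMl.
have t01 : 0 <= t <= 1 by rewrite (ltW t0).
rewrite -(ler_pM2l t0).
have -> : t * (T + h) = mdist (g (T - t * T)) (g (T + t * h)).
  rewrite iso/= ?in_itv/=; [|lra|lra].
  by rewrite distrC ger0_norm; [ring|lra].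
have -> : g (T - t * T) = gp (g T) (g 0) t.
  apply: geodesic_point_unique => //.
    rewrite [mdist (g T) (g 0)]metric_sym gTT iso/= ?in_itv/=; [|lra|lra].
    by rewrite subKr ger0_norm.
  rewrite [mdist (g T) (g 0)]metric_sym gTT metric_sym gT//; lra.
have -> : g (T + t * h) = gp (g T) (g (T + h)) t.
  apply: geodesic_point_unique => //; rewrite gTh iso/= ?in_itv/=; [|lra|lra| |lra|lra].
    by rewrite opprD addrA subrr sub0r normrN ger0_norm.
  by rewrite distrC ger0_norm; lra.
exact: geodesic_point_scale.
Qed.

Lemma local_geodesic_global (g : R -> X) (t : R) :
  locally_isometric g -> 0 <= t -> mdist (g 0) (g t) = t.
Proof.
move=> lg; pose P := [set T | 0 <= T /\ forall u, 0 <= u <= T -> mdist (g 0) (g u) = u].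
suff PT T : 0 <= T -> P T by move=> t0; have [_] := PT _ t0; apply; rewrite t0 lexx.
move=> T0; apply: contrapT => nPT.
have P0 : P 0.
  split=> [|u u0]; first exact: lexx.
  have -> : u = 0 by apply/eqP; rewrite eq_le andbC.
  by rewrite mdistxx.
have ubT : ubound P T.
  move=> u [u0 Pu]; rewrite leNgt; apply/negP => Tu; apply: nPT; split=> [//|v vT].
  by apply: Pu; lra.
have supP : has_sup P by split; [exists 0|exists T].
have [e e0 iso] := lg (sup P).
have e20 : 0 < e / 2 by lra.
have [S PS SP] := sup_adherent e20 supP.
have Sle : S <= sup P by exact: sup_upper_bound.
have [S0 PS'] := PS.
have isoS : isometric_on `]S - e / 2, S + e / 2[ g.
  by move=> u v; rewrite /= !in_itv/= => uS vS; apply: iso; rewrite /= in_itv/=; lra.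
pose h := (sup P - S + e / 2) / 2.
have PSh : P (S + h).
  split=> [|u u0]; first by rewrite /h; lra.
  have [uS|Su] := leP u S; first by apply: PS'; lra.
  have -> : u = S + (u - S) by lra.
  by apply: (local_geodesic_step isoS) => //; rewrite /h in u0; lra.
have /(_ _ PSh) := sup_upper_bound supP; rewrite /h; lra.
Qed.

(** The distance from [p] comes from the local geodesic started at [p], the
    distance from [m] from the same one started at [m]. *)
Lemma geodesic_extension p m (l : R) : geodesically_complete X -> 0 <= l ->
  exists2 z, mdist m z = l & mdist p z = mdist p m + l.
Proof.
move=> gc l0; have [_ geo _] := X_cat0; have [c [c0 cl iso]] := geo p m.
have D0 := mdist_ge0 p m.
have [g lg gc'] := gc _ _ (@interval_is_interval _ _) iso.
have gp' : g 0 = p by rewrite gc'//= in_itv/= lexx D0.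
have gm : g (mdist p m) = m by rewrite gc'//= in_itv/= lexx D0.
exists (g (mdist p m + l)).
  rewrite -{1}gm; pose h u := g (mdist p m + u).
  have lh : locally_isometric h.
    move=> u; have [e e0 isoe] := lg (mdist p m + u); exists e => // a b.
    rewrite /= !in_itv/= => ua ub; rewrite isoe/= ?in_itv/=; [|lra|lra].
    by congr `| _ |; ring.
  by have := local_geodesic_global lh l0; rewrite /h addr0.
by rewrite -{1}gp' local_geodesic_global// addr_ge0.
Qed.

End geodesic_point.

(** * Limits and selections in metric spaces *)

Section metric_space_limits.
Context {R : realType} {X : metricType R}.
Implicit Types (x y z m : X) (A W : set X).

Lemma cvg_mdistP {T : Type} {F : set_system T} {FF : Filter F} (f : T -> X) y :
  f @ F --> y <-> forall e : R, 0 < e -> \forall t \near F, mdist y (f t) < e.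
Proof. exact: metricType_numDomainType.cvgrPdist_lt. Qed.

Lemma cvg_mdist {T : Type} {F : set_system T} {FF : Filter F} (f g : T -> X) a b :
  f @ F --> a -> g @ F --> b -> mdist (f t) (g t) @[t --> F] --> mdist a b.
Proof.
move=> /cvg_mdistP fa /cvg_mdistP gb; apply/cvgrPdist_lt => e e0.
have e20 : 0 < e / 2 by lra.
near=> t; have fat : mdist a (f t) < e / 2 by near: t; exact: fa.
have gbt : mdist b (g t) < e / 2 by near: t; exact: gb.
have h1 := metric_triangle a (f t) b; have h2 := metric_triangle (f t) (g t) b.
have h3 := metric_triangle (f t) a (g t); have h4 := metric_triangle a b (g t).
rewrite [mdist (g t) b]metric_sym in h2; rewrite [mdist (f t) a]metric_sym in h3.
by rewrite ltr_norml; lra.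
Unshelve. all: by end_near. Qed.

Lemma mdist_continuous (z : X) : continuous (mdist z).
Proof. by move=> x; apply: cvg_mdist; [exact: cvg_cst|exact: cvg_id]. Qed.

Lemma cvg_geodesic_point {T : Type} {F : set_system T} {FF : Filter F}
    (f g : T -> X) (l : T -> R) a b c : cat0_space X ->
  f @ F --> a -> g @ F --> b -> l @ F --> c ->
  (\forall t \near F, 0 <= l t <= 1) -> 0 <= c <= 1 ->
  geodesic_point (f t) (g t) (l t) @[t --> F] --> geodesic_point a b c.
Proof.
move=> X_cat0 /cvg_mdistP fa /cvg_mdistP gb /cvgrPdist_lt lc l01 c01.
apply/cvg_mdistP => e e0; have D0 := mdist_ge0 a b.
pose D := 3 * (mdist a b + 1); have Dgt0 : 0 < D by rewrite /D; lra.
have e30 : 0 < e / 3 by lra.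
have eD0 : 0 < e / D by rewrite divr_gt0.
near=> t.
have fat : mdist a (f t) < e / 3 by near: t; exact: fa.
have gbt : mdist b (g t) < e / 3 by near: t; exact: gb.
have lt01 : 0 <= l t <= 1 by near: t.
have lct : `|c - l t| < e / D by near: t; exact: lc.
apply: le_lt_trans (mdist_geodesic_point_le X_cat0 _ _ _ _ c01 lt01) _.
have : `|c - l t| * mdist a b <= e / 3.
  apply: (@le_trans _ _ (e / D * mdist a b)); first by rewrite ler_wpM2r// ltW.
  rewrite mulrAC ler_pdivrMr// /D; lra.
by move: fat gbt; lra.
Unshelve. all: by end_near. Qed.

(** The net is taken inside [A], so that it consists of points with the property
    that defines [A]. *)
Definition totally_bounded A := forall e : R, 0 < e ->
  exists s : seq X, forall x, A x -> exists y, [/\ y \in s, A y & mdist x y < e].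

(** Compactness is used for a covering indexed by the finite sequences of points,
    filtered by inclusion. *)
Lemma compact_totally_bounded (K A : set X) : compact K -> A `<=` K ->
  totally_bounded A.
Proof.
move=> /compact_near_coveringP cK AK e e0.
pose F : set_system (seq X) :=
  filter_from [set: seq X] (fun s0 => [set s : seq X | {subset s0 <= s}]).
have FF : Filter F.
  apply: filter_from_filter; first by exists [::].
  move=> s1 s2 _ _; exists (s1 ++ s2) => // s /= ss; split=> x xs; apply: ss;
    by rewrite mem_cat xs ?orbT.
have e20 : 0 < e / 2 by lra.
have [|s _ /(_ s)/= Ps] := cK _ F
    (fun s x => A x -> exists y, [/\ y \in s, A y & mdist x y < e]) FF.
  move=> x Kx; have [[a [Aa xa]]|none] := pselect (exists a, A a /\ mdist x a < e / 2).
    exists (ball x (e / 2), [set s : seq X | {subset [:: a] <= s}]); rewrite /=.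
      by split; [exact: nbhsx_ballx|exists [:: a]].
    move=> [z s]/= [xz as_] _; exists a; split=> //; first by apply: as_; rewrite mem_head.
    rewrite ballEmdist/= in xz; have := metric_triangle z x a.
    by rewrite [mdist z x]metric_sym; lra.
  exists (ball x (e / 2), setT); first by split; [exact: nbhsx_ballx|exact: filterT].
  move=> [z s]/= [xz _] Az; exfalso; apply: none; exists z; split=> //.
  by rewrite ballEmdist/= in xz.
by exists s => x Ax; apply: Ps => //; exact: AK.
Qed.

Definition unit_clamp (c : R) : R := Num.max 0 (Num.min 1 c).

Lemma unit_clamp01 c : 0 <= unit_clamp c <= 1.
Proof. by rewrite le_max lexx ge_max ler01 ge_min lexx. Qed.

Lemma unit_clamp_continuous : continuous unit_clamp.
Proof.
move=> c; apply: (@continuous_comp _ _ _ (fun r : R => Num.min 1 r) (fun r : R => Num.max 0 r)).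
  by apply: continuous_min; [exact: cst_continuous|exact: id].
by apply: continuous_max; [exact: cst_continuous|exact: id].
Qed.

(** A map that is continuous up to an error [beta] on the scale [eta] lies within
    [beta] of a continuous map. The values at the points of a finite net are
    averaged along geodesics, one net point after the other. The weight of a net
    point [y] is 1 near [y], which erases what was there before, and 0 away from
    [y], where the value at [y] is irrelevant; in between, the ball of radius
    [beta] is convex. Thus no partition of unity is needed. *)
Lemma continuous_selection (N : set X) (f : X -> X) (eta beta : R) :
  cat0_space X -> totally_bounded N -> 0 < eta ->
  (forall x y, N x -> N y -> mdist x y < eta -> mdist (f x) (f y) <= beta) ->
  exists2 Z : X -> X, continuous Z & forall x, N x -> mdist (Z x) (f x) <= beta.
Proof.
move=> X_cat0 tbN eta0 f_eta.
have eta20 : 0 < eta / 2 by lra.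
have [s sN] := tbN _ eta20.
suff [Z cZ ZN] : exists2 Z : X -> X, continuous Z & forall x y, N x -> N y ->
    y \in s -> mdist x y < eta / 2 -> mdist (Z x) (f x) <= beta.
  by exists Z => // x Nx; have [y [ys Ny xy]] := sN _ Nx; exact: (ZN x y).
elim: s {sN} => [|y s [Z cZ ZN]]; first by exists id => // x; exact: cvg_id.
have [Ny|nNy] := pselect (N y); last first.
  exists Z => // x z Nx Nz; rewrite inE => /orP[/eqP zy|]; last exact: ZN.
  by move: Nz; rewrite zy.
(* 1 at distance at most eta / 2 from y, and 0 at distance at least eta *)
pose l x : R := unit_clamp (2 - 2 / eta * mdist x y).
have l01 x : 0 <= l x <= 1 by exact: unit_clamp01.
exists (fun x => geodesic_point (Z x) (f y) (l x)).
  move=> x; apply: cvg_geodesic_point => //;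
    [exact: cZ|exact: cvg_cst| |exact: nearW].
  apply: (@continuous_comp _ _ _ (fun x => 2 - 2 / eta * mdist x y) unit_clamp).
    apply: cvgB; first exact: cvg_cst.
    by apply: cvgM; [exact: cvg_cst|apply: cvg_mdist => //; exact: cvg_cst].
  exact: unit_clamp_continuous.
move=> x z Nx Nz; rewrite inE => zys xz.
have etaxy (c : R) : (2 / eta * mdist x y < c) = (mdist x y < c * (eta / 2)).
  by rewrite -(ltr_pdivrMr _ _ eta20) invf_div mulrC.
have [xy|xy] := ltP (mdist x y) (eta / 2).
  have -> : l x = 1.
    have : 2 / eta * mdist x y < 1 by rewrite etaxy mul1r.
    by rewrite /l /unit_clamp => h; rewrite min_l ?max_r ?ler01//; lra.
  rewrite geodesic_point1// f_eta//; first by rewrite metric_sym; lra.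
have ZNx : mdist (Z x) (f x) <= beta.
  case/orP: zys => [/eqP zy|zs]; last exact: (ZN x z).
  by move: xz; rewrite zy ltNge xy.
have [xy'|xy'] := ltP (mdist x y) eta; last first.
  have -> : l x = 0.
    have : 2 <= 2 / eta * mdist x y.
      by rewrite leNgt etaxy -leNgt; lra.
    by rewrite /l /unit_clamp => h; rewrite max_l// ge_min subr_le0 h orbT.
  by rewrite geodesic_point0.
rewrite metric_sym; apply: le_trans (mdist_convex X_cat0 _ _ _ (l01 x)) _.
have fxy : mdist (f x) (f y) <= beta by exact: f_eta.
rewrite metric_sym in ZNx; have /andP[l0 l1] := l01 x.
have /ler_wpM2l/(_ _ _ ZNx) : 0 <= 1 - l x by lra.
have /ler_wpM2l/(_ _ _ fxy) := l0; lra.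
Unshelve. all: by end_near. Qed.

(** [u] measures how far a point is from the target. Since each step is at most
    [C] times the decrease of [u], the lengths of the steps telescope, and the
    iterates converge uniformly on [W] at a geometric rate. *)
Lemma retraction_of_contracting_iteration W (G : X -> X) (u : X -> R) (k C M : R) :
  complete_space X -> closed W -> continuous G -> continuous u ->
  0 <= k < 1 -> 0 <= C ->
  (forall x, W x -> W (G x)) -> (forall x, W x -> 0 <= u x <= M) ->
  (forall x, W x -> u (G x) <= k * u x) ->
  (forall x, W x -> mdist x (G x) <= C * (u x - u (G x))) ->
  exists P : X -> X, [/\ {within W, continuous P},
    forall x, W x -> W (P x), forall x, W x -> u (P x) = 0 &
    forall x, W x -> u x = 0 -> P x = x].
Proof.
move=> X_complete clW cG cu /andP[k0 k1] C0 GW uW uG dG.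
pose it n x := iter n G x.
have itW n x : W x -> W (it n x) by move=> Wx; elim: n => //= n; exact: GW.
have cit n : continuous (it n).
  elim: n => [|n IHn] x; first exact: cvg_id.
  by apply: (@continuous_comp _ _ _ (it n) G); [exact: IHn|exact: cG].
have uit n x : W x -> u (it n x) <= k ^+ n * M.
  move=> Wx; elim: n => [|n IHn] /=.
    by rewrite expr0 mul1r; have /andP[] := uW _ Wx.
  apply: le_trans (uG _ (itW n _ Wx)) _.
  by rewrite exprS -mulrA ler_wpM2l.
have dit n x : W x -> mdist x (it n x) <= C * (u x - u (it n x)).
  move=> Wx; elim: n => [|n IHn] /=; first by rewrite mdistxx subrr mulr0.
  apply: le_trans (metric_triangle _ (it n x) _) _.
  by have := dG _ (itW n _ Wx); rewrite /it; move: IHn; rewrite /it; lra.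
have dit' n j x : W x -> mdist (it n x) (it (j + n)%N x) <= C * (k ^+ n * M).
  move=> Wx; have -> : it (j + n)%N x = it j (it n x) by rewrite /it iterD.
  apply: le_trans (dit _ _ (itW n _ Wx)) _.
  rewrite ler_wpM2l//; have := uit n _ Wx.
  by have /andP[+ _] := uW _ (itW j _ (itW n _ Wx)); lra.
have small : (fun n => C * (k ^+ n * M)) @ \oo --> (0 : R).
  rewrite -(mulr0 C) -[in X in _ --> X](mul0r M).
  apply: cvgM; first exact: cvg_cst.
  apply: cvgM; last exact: cvg_cst.
  by apply: cvg_expr; rewrite ger0_norm.
have lim x : W x -> exists l : X, it n x @[n --> \oo] --> l.
  move=> Wx; apply: (X_complete (it n x @[n --> \oo])); apply: cauchy_exP => e e0.
  have /cvgrPdist_lt/(_ _ e0) small_e := small.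
  have [n _ /(_ n (leqnn n))] := small_e; rewrite /= sub0r normrN => ne.
  exists (it n x); exists n => // j /= nj; rewrite ballEmdist/=.
  rewrite -(subnK nj); apply: le_lt_trans (dit' _ _ _ Wx) _.
  by apply: le_lt_trans ne; exact: ler_norm.
have [P Plim] : exists P : X -> X, forall x, W x -> it n x @[n --> \oo] --> P x.
  have : forall x, exists l : X, W x -> it n x @[n --> \oo] --> l.
    move=> x; have [Wx|nWx] := pselect (W x); last by exists x.
    by have [l ?] := lim _ Wx; exists l.
  by move=> /choice[P ?]; exists P.
have dP n x : W x -> mdist (it n x) (P x) <= C * (k ^+ n * M).
  move=> Wx; apply: (@cvgr_to_le _ \oo _ _ (fun j => mdist (it n x) (it j x))).
    by apply: cvg_mdist; [exact: cvg_cst|exact: Plim].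
  by exists n => // j /= nj; rewrite -(subnK nj); exact: dit'.
exists P; split.
- apply/subspace_continuousP => x Wx; apply/cvg_mdistP => e e0.
  have e30 : 0 < e / 3 by lra.
  have /cvgrPdist_lt/(_ _ e30) small_e := small.
  have [n _ /(_ n (leqnn n))] := small_e; rewrite /= sub0r normrN => /ltr_normlW ne.
  have := cit n x; move/cvg_mdistP => /(_ _ e30) cn.
  rewrite near_withinE; near=> z => Wz.
  have cz : mdist (it n x) (it n z) < e / 3 by near: z; exact: cn.
  change (mdist (P x) (P z) < e).
  have h1 := metric_triangle (P x) (it n x) (P z).
  have h2 := metric_triangle (it n x) (it n z) (P z).
  have h3 := dP n _ Wx; rewrite metric_sym in h3; have h4 := dP n _ Wz; lra.
- move=> x Wx; apply: (@closed_cvg _ _ \oo _ (fun n => it n x) W clW _ _ (Plim _ Wx)).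
  by apply: nearW => n; exact: itW.
- move=> x Wx; apply: (@cvg_unique R _ (u (it n x) @[n --> \oo])).
  + exact: norm_hausdorff.
  + by apply: (@cvg_comp _ _ _ (fun n => it n x) u); [exact: Plim|exact: cu].
  + apply: (@squeeze_cvgr _ _ _ _ (fun=> 0) (fun n => k ^+ n * M)).
    * apply: nearW => n; rewrite uit// andbT.
      by have /andP[] := uW _ (itW n _ Wx).
    * exact: cvg_cst.
    * rewrite -[X in _ --> X](mul0r M); apply: cvgM; last exact: cvg_cst.
      by apply: cvg_expr; rewrite ger0_norm.
- move=> x Wx ux0; apply: (@cvg_unique X _ (it n x @[n --> \oo])).
  + exact: metric_hausdorff.
  + exact: Plim.
  + rewrite (_ : (fun n => it n x) = fun=> x); first exact: cvg_cst.
    apply/funext => n; apply/esym/mdist_positivity/eqP.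
    rewrite eq_le mdist_ge0 andbT; apply: le_trans (dit _ _ Wx) _.
    rewrite ux0 sub0r mulrN oppr_le0 mulr_ge0//.
    by have /andP[] := uW _ (itW n _ Wx).
Unshelve. all: by end_near. Qed.

End metric_space_limits.

(** * First-order behaviour of geodesics at a point *)

Section first_order.
Context {R : realType}.

(** Dini's theorem for functions of [t] that decrease to their infimum as [t]
    tends to 0: if the family is totally bounded in the uniform norm, then one
    [t0] is good for the whole family. The infimum does not appear; being close
    to it is expressed by comparison with the value at any [a]. *)
Lemma uniform_infimum {T : eqType} (A : T -> Prop) (q : T -> R -> R) :
  (forall x s t, 0 < s -> s <= t -> t <= 1 -> q x s <= q x t) ->
  (forall x, exists b, forall t, 0 < t <= 1 -> b <= q x t) ->
  (forall e, 0 < e -> exists s : seq T, forall x, A x -> exists2 y, y \in s &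
    forall t, 0 < t <= 1 -> `|q x t - q y t| <= e) ->
  forall e, 0 < e -> exists2 t0, 0 < t0 <= 1 &
    forall x a, A x -> 0 < a <= 1 -> q x t0 <= q x a + e.
Proof.
move=> qmono qbnd qnet e e0; have e30 : 0 < e / 3 by lra.
have [s sA] := qnet _ e30.
have q_inf y : exists2 t0, 0 < t0 <= 1 &
    forall a, 0 < a <= 1 -> q y t0 <= q y a + e / 3.
  have [b bq] := qbnd y; pose V := [set q y t | t in [set t | 0 < t <= 1]].
  have V_inf : has_inf V.
    split; first by exists (q y 1); exists 1 => //=; rewrite ltr01 lexx.
    by exists b => _ [t t01 <-]; exact: bq.
  have [_ [t0 t001 <-] qt0] := inf_adherent e30 V_inf.
  exists t0 => // a a01; apply: le_trans (ltW qt0) _; rewrite lerD2r.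
  by apply: ge_inf; [have [] := V_inf|exists a].
have [t0 t001 st0] : exists2 t0, 0 < t0 <= 1 &
    forall y, y \in s -> forall a, 0 < a <= 1 -> q y t0 <= q y a + e / 3.
  elim: s {sA} => [|y s [t1 t101 IHs]]; first by exists 1 => //; rewrite ltr01 lexx.
  have [t2 t201 yt2] := q_inf y.
  have t12 : 0 < Num.min t1 t2 by rewrite lt_min; lra.
  exists (Num.min t1 t2); first by rewrite t12 ge_min; lra.
  move=> z; rewrite inE => /orP[/eqP ->|zs] a a01.
    apply: le_trans (yt2 _ a01); apply: qmono => //; last by lra.
    by rewrite ge_min lexx orbT.
  apply: le_trans (IHs _ zs _ a01); apply: qmono => //; last by lra.
  by rewrite ge_min lexx.
exists t0 => // x a Ax a01; have [y ys xy] := sA _ Ax.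
have := st0 _ ys _ a01; have := xy _ t001; have := xy _ a01.
by rewrite !ler_norml; lra.
Qed.

Context {X : metricType R}.
Hypothesis X_cat0 : cat0_space X.
Local Notation gp := geodesic_point.
Implicit Types (x y z m o p : X) (A : set X).

Lemma geodesic_spread_mono p z z' s t : 0 < s -> s <= t -> t <= 1 ->
  mdist (gp p z s) (gp p z' s) / s <= mdist (gp p z t) (gp p z' t) / t.
Proof.
move=> s0 st t1; have t0 : 0 < t by lra.
have st01 : 0 <= s / t <= 1.
  by rewrite divr_ge0 ?(ltW s0) ?(ltW t0)//= ler_pdivrMr// mul1r.
have t01 : 0 <= t <= 1 by lra.
have gpE y : gp p y s = gp p (gp p y t) (s / t).
  by rewrite geodesic_point_geodesic_point// divfK// gt_eqF.
rewrite ler_pdivrMr// mulrAC -mulrA [leRHS]mulrC (gpE z) (gpE z').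
exact: geodesic_point_scale.
Qed.

Lemma mdist_slope_mono o p z s t : 0 < s -> s <= t -> t <= 1 ->
  (mdist o (gp p z s) - mdist o p) / s <= (mdist o (gp p z t) - mdist o p) / t.
Proof.
move=> s0 st t1; have t0 : 0 < t by lra.
have st01 : 0 <= s / t <= 1.
  by rewrite divr_ge0 ?(ltW s0) ?(ltW t0)//= ler_pdivrMr// mul1r.
have t01 : 0 <= t <= 1 by lra.
have gpE : gp p z s = gp p (gp p z t) (s / t).
  by rewrite geodesic_point_geodesic_point// divfK// gt_eqF.
rewrite ler_pdivrMr// mulrAC -mulrA.
have := mdist_convex X_cat0 o p (gp p z t) st01; rewrite -gpE; lra.
Qed.

(** For small [t0] the geodesics from [p] to [z] and to [z'] are no further apart
    at [t0], in proportion, than they are at any [a], up to [e]. In particular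
    two geodesics that agree at some [a] are almost the same at [t0]. *)
Lemma geodesic_spread_uniform p A e : totally_bounded A -> 0 < e ->
  exists2 t0, 0 < t0 <= 1 & forall z z' a, A z -> A z' -> 0 < a <= 1 ->
    mdist (gp p z t0) (gp p z' t0) / t0 <= mdist (gp p z a) (gp p z' a) / a + e.
Proof.
move=> tbA e0.
pose q (zz : X * X) t := mdist (gp p zz.1 t) (gp p zz.2 t) / t.
have [| | |t0 t001 qt0] := @uniform_infimum (X * X)%type
    (fun zz => A zz.1 /\ A zz.2) q _ _ _ e e0.
- by move=> zz s t; exact: geodesic_spread_mono.
- by move=> zz; exists 0 => t /andP[t0 _]; rewrite divr_ge0 ?mdist_ge0 ?(ltW t0).
- move=> d d0; have d20 : 0 < d / 2 by lra.
  have [s sA] := tbA _ d20; exists [seq (x, y) | x <- s, y <- s].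
  move=> [z z'] [/= Az Az']; have [y [ys _ zy]] := sA _ Az.
  have [y' [ys' _ zy']] := sA _ Az'.
  exists (y, y'); first exact: allpairs_f.
  move=> t /andP[t0 t1]; rewrite /q/= -mulrBl normrM normfV (gtr0_norm t0) ler_pdivrMr//.
  have t01 : 0 <= t <= 1 by lra.
  have h1 := geodesic_point_scale X_cat0 p z y t01.
  have h2 := geodesic_point_scale X_cat0 p z' y' t01.
  have h3 := metric_triangle (gp p z t) (gp p y t) (gp p z' t).
  have h4 := metric_triangle (gp p y t) (gp p y' t) (gp p z' t).
  have h5 := metric_triangle (gp p y t) (gp p z t) (gp p y' t).
  have h6 := metric_triangle (gp p z t) (gp p z' t) (gp p y' t).
  rewrite [mdist (gp p y' t) (gp p z' t)]metric_sym in h4.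
  rewrite [mdist (gp p y t) (gp p z t)]metric_sym in h5.
  have h7 : t * (mdist z y + mdist z' y') <= t * d by rewrite ler_wpM2l ?(ltW t0)//; lra.
  by rewrite ler_norml; lra.
by exists t0 => // z z' a Az Az' a01; apply: (qt0 (z, z')).
Qed.

Lemma mdist_slope_uniform o p A e : totally_bounded A -> 0 < e ->
  exists2 t0, 0 < t0 <= 1 & forall z a, A z -> 0 < a <= 1 ->
    (mdist o (gp p z t0) - mdist o p) / t0 <=
    (mdist o (gp p z a) - mdist o p) / a + e.
Proof.
move=> tbA; apply: uniform_infimum.
- by move=> z s t; exact: mdist_slope_mono.
- move=> z; exists (- mdist p z) => t /andP[t0 t1]; have t01 : 0 <= t <= 1 by lra.
  rewrite ler_pdivlMr//.
  have := metric_triangle o (gp p z t) p; rewrite [mdist (gp p z t) p]metric_sym.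
  by rewrite mdist_geodesic_point//; lra.
- move=> d d0; have [s sA] := tbA _ d0; exists s => z Az.
  have [y [ys _ zy]] := sA _ Az; exists y => // t /andP[t0 t1].
  have t01 : 0 <= t <= 1 by lra.
  rewrite -mulrBl normrM normfV (gtr0_norm t0) ler_pdivrMr//.
  have h1 := geodesic_point_scale X_cat0 p z y t01.
  have h2 := metric_triangle o (gp p z t) (gp p y t).
  have h3 := metric_triangle o (gp p y t) (gp p z t).
  rewrite [mdist (gp p y t) (gp p z t)]metric_sym in h3.
  have h7 : t * mdist z y <= t * d by rewrite ler_wpM2l ?(ltW t0)//; lra.
  by rewrite ler_norml; lra.
Qed.

End first_order.

(** * Pushing points away from p *)

Section radial_push.
Context {R : realType} {X : metricType R}.
Hypotheses (X_cat0 : cat0_space X) (X_gc : geodesically_complete X).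
Local Notation gp := geodesic_point.
Implicit Types (x y z m o p : X).

(** [f m] is a point at distance [L] from [p] on some geodesic that prolongs the
    one from [p] to [m]. The choice of it is arbitrary, but almost continuous, and
    [f m] is almost in the ball around [o] if [m] is in it. All estimates are
    relative to [L], and [L] does not depend on [m]: the nearer [m] is to [p], the
    smaller the perturbation of [m] that is allowed. *)
Lemma radial_extension o p (rho : R) : 0 < rho ->
  totally_bounded [set z | mdist p z = rho] ->
  exists2 L : R, 0 < L & exists f : X -> X, forall m, 0 < mdist p m <= L ->
  [/\ mdist p (f m) = L, mdist m (f m) = L - mdist p m,
      forall m', 0 < mdist p m' <= L -> mdist m m' <= mdist p m / 32 ->
        mdist (f m) (f m') <= L / 8 &
      mdist o m <= mdist o p -> mdist o (f m) <= mdist o p + L / 16].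
Proof.
move=> rho0 tb; have d0 : 0 < rho / 16 by lra.
have [t1 t101 spread] := geodesic_spread_uniform X_cat0 p tb d0.
have [t2 t201 slope] := mdist_slope_uniform X_cat0 o p tb d0.
have [t [t0 tt1 tt2]] : exists t, [/\ 0 < t, t <= t1 & t <= t2].
  exists (Num.min t1 t2); split; first by rewrite lt_min; lra.
    by rewrite ge_min lexx.
  by rewrite ge_min lexx orbT.
have t01 : 0 <= t <= 1 by lra.
have L0 : 0 < t * rho by rewrite mulr_gt0.
have Lrho : t * rho <= rho by rewrite ger_pMl//; lra.
exists (t * rho) => //.
(* z m lies on the sphere of radius rho, and m on the geodesic from p to z m *)
have [z zP] : exists z : X -> X, forall m, 0 < mdist p m <= t * rho ->
    mdist m (z m) = rho - mdist p m /\ mdist p (z m) = rho.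
  have : forall m, exists z, 0 < mdist p m <= t * rho ->
      mdist m z = rho - mdist p m /\ mdist p z = rho.
    move=> m; have [mL|] := boolP (0 < mdist p m <= t * rho); last by exists m.
    have l0 : 0 <= rho - mdist p m by lra.
    have [z mz pz] := geodesic_extension X_cat0 p m X_gc l0.
    by exists z => _; split=> //; rewrite pz addrC subrK.
  by move=> /choice[z zP]; exists z.
have [a arho] : exists a : X -> R, forall m, a m * rho = mdist p m.
  by exists (fun m => mdist p m / rho) => m; rewrite divfK// gt_eqF.
have a01 m : 0 < mdist p m <= t * rho -> 0 < a m <= t.
  by rewrite -arho pmulr_lgt0// ler_pM2r.
have zE m : 0 < mdist p m <= t * rho -> m = gp p (z m) (a m).
  move=> mL; have [mz pz] := zP _ mL; have am := a01 _ mL.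
  by apply: geodesic_point_unique => //; rewrite ?pz ?mulrBl ?mul1r ?arho ?mz//; lra.
exists (fun m => gp p (z m) t) => m mL; have [mz pz] := zP _ mL; have am := a01 _ mL.
have am01 : 0 < a m <= 1 by lra.
have am01' : 0 <= a m <= 1 by lra.
have pf : mdist p (gp p (z m) t) = t * rho by rewrite mdist_geodesic_point// pz.
split=> //.
- apply/eqP; rewrite eq_le; apply/andP; split; last first.
    by have := metric_triangle p m (gp p (z m) t); rewrite pf; lra.
  rewrite {1}(zE _ mL); apply: le_trans (geodesic_point_lip X_cat0 _ _ am01' t01) _.
  by rewrite pz distrC ger0_norm ?mulrBl ?arho//; lra.
- move=> m' mL' mm'; have [mz' pz'] := zP _ mL'; have am' := a01 _ mL'.
  have am01'' : 0 <= a m' <= 1 by lra.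
  (* compare m' with the point of the geodesic to z m' at the radius of m *)
  have near_a : mdist (gp p (z m) (a m)) (gp p (z m') (a m)) <= a m * (rho / 16).
    rewrite -(zE _ mL); apply: le_trans (metric_triangle _ m' _) _.
    rewrite mulrA arho.
    suff : mdist m' (gp p (z m') (a m)) <= mdist m m' by lra.
    rewrite {1}(zE _ mL'); apply: le_trans (geodesic_point_lip X_cat0 _ _ am01'' am01') _.
    rewrite pz' -[X in _ * X](gtr0_norm rho0) -normrM mulrBl !arho ler_norml.
    have := metric_triangle p m m'; have := metric_triangle p m' m.
    by rewrite [mdist m' m]metric_sym; lra.
  have h1 := spread (z m) (z m') (a m) pz pz' am01.
  have h2 := geodesic_spread_mono X_cat0 p (z m) (z m') t0 tt1 (_ : t1 <= 1).
  have {}h2 := h2 (ltac:(by case/andP: t101)).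
  have h3 : mdist (gp p (z m) (a m)) (gp p (z m') (a m)) / a m <= rho / 16.
    by case/andP: am => a0 _; rewrite ler_pdivrMr// [leRHS]mulrC.
  have := le_trans h2 (le_trans h1 (lerD h3 (lexx (rho / 16)))).
  rewrite ler_pdivrMr// => /le_trans; apply.
  by rewrite le_eqVlt; apply/orP; left; apply/eqP; field.
- move=> om; have h1 := slope (z m) (a m) pz am01.
  have h2 := mdist_slope_mono X_cat0 o p (z m) t0 tt2 (ltac:(by case/andP: t201)).
  have h3 : (mdist o (gp p (z m) (a m)) - mdist o p) / a m <= 0.
    by rewrite -(zE _ mL) pmulr_lle0 ?invr_gt0 ?subr_le0//; case/andP: am.
  have := le_trans h2 (le_trans h1 (lerD h3 (lexx (rho / 16)))).
  rewrite add0r ler_pdivrMr// lerBlDl => /le_trans; apply.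
  by rewrite lerD2l le_eqVlt; apply/orP; left; apply/eqP; field.
Qed.

(** [G] moves [m] along the geodesic towards the approximate prolongation point
    [Z m], which is about [L] away, by the ratio [(s - mdist p m) / (2 * L)],
    thus by about half of the gap [s - mdist p m]. The factor 2 leaves room for
    the error of [Z], so that [G m] does not overshoot the sphere. The bound
    [s <= L / 16] makes the distances from [p] negligible against [L]. *)
Lemma radial_push o p : locally_compact [set: X] ->
  exists2 e : R, 0 < e & forall s, 0 < s < e -> exists2 G : X -> X, continuous G &
    forall m, s / 3 <= mdist p m <= s -> mdist o m <= mdist o p ->
    [/\ mdist m (G m) <= s - mdist p m,
        mdist p m + (s - mdist p m) / 4 <= mdist p (G m) &
        mdist o (G m) <= mdist o m + (s - mdist p m) / 8].
Proof.
move=> /(_ p Logic.I)[U]; rewrite withinET => /nbhs_ballP[r /= r0 rU] [cU _].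
have tb A : A `<=` ball p r -> totally_bounded A.
  by move=> Ar; apply: (compact_totally_bounded cU); exact: subset_trans rU.
have r20 : 0 < r / 2 by lra.
have [|L L0 [f fP]] := @radial_extension o p (r / 2) r20.
  by apply: tb => z /= pz; rewrite ballEmdist/= pz; lra.
exists (Num.min (L / 16) r); first by rewrite lt_min r0 andbT; lra.
move=> s; rewrite lt_min => /and3P[s0 sL sr].
(* the lower bound makes one scale of almost continuity of f work on all of N *)
pose N := [set m | s / 3 <= mdist p m <= s].
have NL m : N m -> 0 < mdist p m <= L by rewrite /N/=; lra.
have tbN : totally_bounded N.
  by apply: tb => z /=; rewrite /N ballEmdist/=; lra.
have [||Z cZ Zf] := @continuous_selection _ _ N f (s / 96) (L / 8) X_cat0 tbN.
- by lra.
- move=> m m' Nm Nm' mm'; have [_ _ + _] := fP _ (NL _ Nm).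
  by apply; [exact: NL|move: Nm; rewrite /N/=; lra].
pose l m : R := unit_clamp ((s - mdist p m) / (2 * L)).
have l01 m : 0 <= l m <= 1 by exact: unit_clamp01.
exists (fun m => gp m (Z m) (l m)).
  move=> m; apply: cvg_geodesic_point => //; [exact: cZ| |exact: nearW].
  apply: (@continuous_comp _ _ _ (fun m => (s - mdist p m) / (2 * L)) unit_clamp).
    apply: cvgM; last exact: cvg_cst.
    by apply: cvgB; [exact: cvg_cst|exact: mdist_continuous].
  exact: unit_clamp_continuous.
move=> m Nm om; have mL := NL _ Nm; have [pf mf _ of_] := fP _ mL.
have {}of_ := of_ om; have Zfm := Zf _ Nm; have {}l01 := l01 m.
have /andP[N1 N2] : s / 3 <= mdist p m <= s by [].
set u := s - mdist p m; set v := mdist p m in pf mf of_ N1 N2 mL u *.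
have u0 : 0 <= u by rewrite /u; lra.
have us : u <= s by rewrite /u; lra.
have lL : l m * (2 * L) = u.
  have L20 : 0 < 2 * L by lra.
  rewrite /l /unit_clamp -/v -/u min_r ?max_r ?divr_ge0 ?(ltW L20)//; last first.
    by rewrite ler_pdivrMr//; lra.
  by rewrite divfK// gt_eqF.
have /andP[l0 l1] := l01.
(* G m is compared with the point at the same ratio on the geodesic to f m *)
have mG := mdist_geodesic_point X_cat0 m (Z m) l01.
have GG0 := geodesic_point_scale X_cat0 m (Z m) (f m) l01.
have G0f := geodesic_point_mdist X_cat0 m (f m) l01.
have oG0 := mdist_convex X_cat0 o m (f m) l01.
have lZf := ler_wpM2l l0 Zfm.
have lv : l m * v <= l m * (L / 16) by rewrite ler_wpM2l//; lra.
have v0 : 0 <= l m * v by rewrite mulr_ge0//; lra.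
split.
- rewrite mG; have := metric_triangle m (f m) (Z m); rewrite [mdist (f m) _]metric_sym.
  by move=> h; have := ler_wpM2l l0 h; rewrite mf; lra.
- have h1 := metric_triangle p (gp m (f m) (l m)) (f m).
  have h2 := metric_triangle p (gp m (Z m) (l m)) (gp m (f m) (l m)).
  by move: G0f; rewrite mf => G0f; rewrite pf in h1; lra.
- have h1 := metric_triangle o (gp m (f m) (l m)) (gp m (Z m) (l m)).
  rewrite [mdist (gp m (f m) _) _]metric_sym in h1.
  have h2 := metric_triangle o m p; rewrite [mdist m p]metric_sym -/v in h2.
  have h3 : l m * (mdist o (f m) - mdist o m) <= l m * (L / 16 + v).
    by rewrite ler_wpM2l//; lra.
  by lra.
Qed.

End radial_push.

(** * The contraction *)

Section contraction.
Context {R : realType} {X : metricType R}.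
Hypothesis X_cat0 : cat0_space X.
Local Notation gp := geodesic_point.

(** The points from which the iterated push reaches the sphere around [p] without
    leaving the ball around [o]: the gap to the sphere costs half its size in
    distance to [o]. On the sphere this is the ball around [o]. The lower bound
    keeps away from [p]. *)
Definition push_region (o p : X) (s : R) : set X := [set m |
  [/\ s / 3 <= mdist p m, mdist p m <= s &
      mdist o m + (s - mdist p m) / 2 <= mdist o p]].

Lemma push_region_closed o p s : closed (push_region o p s).
Proof.
have -> : push_region o p s =
    mdist p @^-1` [set x | s / 3 <= x] `&` mdist p @^-1` [set x | x <= s] `&`
    (fun m => mdist o m + (s - mdist p m) / 2) @^-1` [set x | x <= mdist o p].
  by apply/seteqP; split => m /=; [case|case=> -[]].
apply: closedI; first apply: closedI.
- by apply: preimage_closed; [move=> x _; exact: mdist_continuous|exact: closed_ge].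
- by apply: preimage_closed; [move=> x _; exact: mdist_continuous|exact: closed_le].
apply: preimage_closed; last exact: closed_le.
move=> x _; apply: cvgD; first exact: mdist_continuous.
apply: cvgM; last exact: cvg_cst.
by apply: cvgB; [exact: cvg_cst|exact: mdist_continuous].
Qed.

(** At ratio [t] the geodesic is closer to [o] than [p] by [t * s] at least, and
    its gap to the sphere is at most [t * (2 * s)]. Its distance from [p] is at
    least [t * s], since [o] is that much closer, and at least
    [s - t * (2 * s)]; one of these is at least [s / 3]. *)
Lemma geodesic_in_push_region o p q x s t : 0 <= s ->
  mdist p q = s -> mdist o q = mdist o p - s ->
  mdist p x = s -> mdist o x <= mdist o p -> 0 <= t <= 1 ->
  push_region o p s (gp x q t).
Proof.
move=> s0 pq oq px ox t01; have /andP[t0 t1] := t01.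
have xq : mdist x q <= 2 * s.
  by have := metric_triangle x p q; rewrite [mdist x p]metric_sym pq px; lra.
have tox : (1 - t) * mdist o x <= (1 - t) * mdist o p.
  by rewrite ler_wpM2l//; lra.
have txq : t * mdist x q <= t * (2 * s) by rewrite ler_wpM2l.
have xm := mdist_geodesic_point X_cat0 x q t01.
have om := mdist_convex X_cat0 o x q t01.
have pm := mdist_convex X_cat0 p x q t01.
have opm := metric_triangle o (gp x q t) p.
rewrite [mdist (gp x q t) p]metric_sym in opm.
have pxm := metric_triangle p (gp x q t) x.
rewrite [mdist (gp x q t) x]metric_sym in pxm.
rewrite oq in om; rewrite pq px in pm.
split; [|lra|lra].
have [t3|t3] := leP (1 / 3) t; last by have := ler_wpM2r s0 (ltW t3); lra.
by have := ler_wpM2r s0 t3; lra.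
Qed.

(** The homotopy runs along the geodesics to [q] in [W] and retracts them to
    [A]. *)
Lemma contractible_geodesic_retract (A W : set X) (P : X -> X) q :
  A q -> {within W, continuous P} -> (forall m, W m -> A (P m)) ->
  (forall x, A x -> P x = x) ->
  (forall x t, A x -> 0 <= t <= 1 -> W (gp x q t)) -> contractible R A.
Proof.
move=> Aq cP WA PA AW; exists q => //.
exists (fun z => P (gp z.1 q z.2)); split => /=.
- apply/subspace_continuousP => -[x t] [/= Ax t01].
  rewrite in_itv/= in t01.
  have cPW : P z @[z --> within W (nbhs (gp x q t))] --> P (gp x q t).
    by move/subspace_continuousP: cP; apply; exact: AW.
  apply: (@cvg_comp _ _ _ (fun z => gp z.1 q z.2) P _ _ _ _ cPW).
  have cgp : geodesic_point z.1 q z.2 @[z --> within (A `*` `[0, 1]) (nbhs (x, t))]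
      --> gp x q t.
    apply: cvg_geodesic_point => //.
    + by apply: cvg_trans; [apply: cvg_app; exact: cvg_within|exact: cvg_fst].
    + exact: cvg_cst.
    + by apply: cvg_trans; [apply: cvg_app; exact: cvg_within|exact: cvg_snd].
    + by rewrite near_withinE; apply: nearW => -[y c] [/= _]; rewrite in_itv.
  move=> B; rewrite /within/= => /cgp/=.
  rewrite /nbhs/= /within/=; apply: filterS => -[y c]/= yB [Ay c01].
  by apply: yB => //; apply: AW => //; rewrite in_itv/= in c01.
- by move=> x t Ax t01; apply: WA; exact: AW.
- by move=> x Ax; rewrite geodesic_point0// PA.
- by move=> x Ax; rewrite geodesic_point1// PA.
Qed.

End contraction.

Theorem theorem1p9 (R : realType) (X : metricType R)
    (X_lc : locally_compact [set: X]) (X_gc : geodesically_complete X)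
    (X_cat0 : cat0_space X) (o p : X) (r : R) (r_gt0 : 0 < r)
    (op_r : mdist o p = r) :
  exists2 e : R, 0 < e &
    forall s : R, 0 < s < e ->
      contractible R (distance_sphere p s `&` closed_distance_ball o r).
Proof.
have [e e0 push] := radial_push X_cat0 X_gc o p X_lc.
exists (Num.min e r); first by rewrite lt_min e0.
move=> s /andP[s0]; rewrite lt_min => /andP[se sr].
have [|G cG Gpush] := push s; first by rewrite s0.
(* u <= s on W; by push, u shrinks by 3 / 4, and a step is at most 4 times the
   decrease of u *)
pose u m := s - mdist p m; pose W := push_region o p s.
have cu : continuous u.
  by move=> x; apply: cvgB; [exact: cvg_cst|exact: mdist_continuous].
have GW m : W m -> [/\ mdist m (G m) <= u m,
    mdist p m + u m / 4 <= mdist p (G m) & mdist o (G m) <= mdist o m + u m / 8].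
  by move=> [m3 ms mo]; apply: Gpush; [rewrite m3 ms|lra].
have [X_complete _ _] := X_cat0.
have [||||||P [cP WP uP idP]] := @retraction_of_contracting_iteration R X W G u
  (3 / 4) 4 s X_complete (@push_region_closed _ _ o p s) cG cu.
- by lra.
- by [].
- move=> m Wm; have [h1 h2 h3] := GW _ Wm; case: Wm => m3 ms mo.
  by have h4 := metric_triangle p m (G m); rewrite /u in h1 h2 h3; split; lra.
- by move=> m [m3 ms mo]; rewrite /u; lra.
- by move=> m Wm; have [h1 h2 h3] := GW _ Wm; rewrite /u in h2 *; lra.
- by move=> m Wm; have [h1 h2 h3] := GW _ Wm; rewrite /u in h1 h2 *; lra.
pose q := geodesic_point p o (s / r).
have sr01 : 0 <= s / r <= 1.
  by rewrite divr_ge0 ?(ltW s0) ?(ltW r_gt0)//= ler_pdivrMr// mul1r ltW.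
have po : mdist p o = r by rewrite metric_sym.
have pq : mdist p q = s by rewrite mdist_geodesic_point// po divfK// gt_eqF.
have oq : mdist o q = mdist o p - s.
  by rewrite metric_sym geodesic_point_mdist// po op_r mulrBl mul1r divfK// gt_eqF.
apply: (@contractible_geodesic_retract _ _ X_cat0 _ W P q) => //.
- by split=> //=; rewrite /closed_distance_ball/= oq; lra.
- move=> m Wm; have := uP _ Wm; have [_ _] := WP _ Wm.
  by rewrite /u => h1 h2; split; rewrite /= /distance_sphere /closed_distance_ball /=; lra.
- move=> x [/= px ox]; rewrite /distance_sphere /closed_distance_ball/= in px ox.
  by apply: idP; [split; lra|rewrite /u; lra].
- move=> x t [/= px ox] t01; apply: geodesic_in_push_region => //; first exact: ltW.
  by rewrite op_r.
Qed.
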